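(* For every integer $n \geq 1$, \[ \sum_{\sigma\in\mathcal{Q}_n} x^{\operatorname{ap}(\sigma)}(-1)^{\operatorname{even}(\sigma)} = \sum_{\pi\in \overline{\mathfrak{S}}_n}x^{\operatorname{asc}(\pi)}(-1)^{\operatorname{mark}(\pi)} = 1. \]
   Context: Let $[n]_2$ be the multiset $\{1,1,2,2,\dots,n,n\}$. A Stirling permutation of order $n$ is a permutation $\sigma=\sigma_1\cdots\sigma_{2n}$ of $[n]_2$ such that for each $i\in[n]$ every entry between the two occurrences of $i$ is greater than $i$; $\mathcal{Q}_n$ denotes the set of these. An ascent plateau of $\sigma$ is an entry $\sigma_i$ with $2\le i\le 2n-1$ and $\sigma_{i-1}<\sigma_i=\sigma_{i+1}$; $\operatorname{ap}(\sigma)$ is their number. An entry $k$ of $\sigma$ is even indexed if the first occurrence of $k$ is at an even position; $\operatorname{even}(\sigma)$ is the number of even indexed values. A left-to-right minimum of a permutation $\pi=\pi_1\cdots\pi_n$ is an entry $\pi_i$ with $i=1$ or $\pi_i<\pi_j$ for all $j<i$. A marked permutation of $[n]$ is a permutation of $[n]$ together with marks on some (possibly none) of its entries that are not left-to-right minima; $\overline{\mathfrak{S}}_n$ is the set of marked permutations of $[n]$. For $\pi\in\overline{\mathfrak{S}}_n$, $\operatorname{mark}(\pi)$ is the number of marked entries and $\operatorname{asc}(\pi)$ is the number of $i\in\{2,\dots,n\}$ with $\pi_i>\pi_{i-1}$ (marks ignored). *)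

(* Defs.v *)
From HB Require Import structures.
From mathcomp Require Import all_boot all_order all_algebra all_fingroup.
Set Implicit Arguments. Unset Strict Implicit. Unset Printing Implicit Defensive.
Import GRing.Theory.

Definition multiset2 (n : nat) : seq nat := flatten [seq [:: i; i] | i <- iota 1 n].

Definition stirlingb (s : seq nat) : bool :=
  all (fun i => all (fun j =>
         (nth 0 s i != nth 0 s j) ||
         all (fun k => nth 0 s i < nth 0 s k) (iota i.+1 (j - i.+1)))
       (iota i.+1 (size s - i.+1)))
    (iota 0 (size s)).

Definition stirling_perms (n : nat) : seq (seq nat) :=
  [seq s <- permutations (multiset2 n) | stirlingb s].

(* ap: 1-indexed positions i in 2..2n-1 with s_{i-1} < s_i = s_{i+1};
   here 0-indexed i in 1..size s - 2. *)
Definition ap (s : seq nat) : nat :=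
  count (fun i => (nth 0 s i.-1 < nth 0 s i) && (nth 0 s i == nth 0 s i.+1))
        (iota 1 (size s - 2)).

(* even: values k in [n] whose first occurrence is at an even (1-indexed)
   position, i.e. at an odd 0-indexed position. *)
Definition even_idx (n : nat) (s : seq nat) : nat :=
  count (fun k => odd (index k s)) (iota 1 n).

Definition lrmin n (p : 'S_n) (i : 'I_n) : bool :=
  [forall j : 'I_n, (j < i) ==> (p i < p j)].

Definition marked n (pm : 'S_n * {set 'I_n}) : bool :=
  [forall i in pm.2, ~~ lrmin pm.1 i].

Definition mark n (pm : 'S_n * {set 'I_n}) : nat := #|pm.2|.

Definition asc n (p : 'S_n) : nat :=
  #|[set i : 'I_n | [exists j : 'I_n, (j.+1 == i :> nat) && (p j < p i)]]|.

(* Main.v *)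
(** Deleting the two copies of the maximum [k = n.+1], which are adjacent, maps the Stirling
    permutations of order [n.+1] onto those of order [n], the fibre of [s] being
    the insertions of [kk] in the [2n+1] gaps of [s].  Inserting [kk] in gap [j]
    adds [odd j] to the number of even indexed values; it adds one ascent
    plateau, unless [j = 0] or the gap touches an ascent plateau of [s], in which
    cases their number is unchanged.  The two gaps touching a given ascent plateau
    have opposite parities, so the contributions of all gaps [j > 0] cancel and the
    signed sum does not depend on [n].  On the other side, the alternating sum over
    the marks vanishes unless every entry is a left-to-right minimum, which leaves
    only the decreasing permutation. *)
Require Import Defs.
From HB Require Import structures.
From mathcomp Require Import all_boot all_order all_algebra all_fingroup.
From mathcomp Require Import ring zify.
Import GRing.Theory.
Local Open Scope ring_scope.

(** * Inserting an adjacent pair of a new maximum into a word *)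

Section Insertion.
Set Implicit Arguments. Unset Strict Implicit.
Local Open Scope nat_scope.

(** In this form the condition visibly passes to subsequences, which spares index arithmetic when
    letters are deleted. The case y = x rules out three equal entries, as the indexed form also
    does. *)
Lemma stirlingbP (s : seq nat) :
  reflect (forall x y, subseq [:: x; y; x] s -> x < y) (stirlingb s).
Proof.
apply: (iffP idP) => [/allP hs x y | hs].
  rewrite -{1}(mkseq_nth 0 s) /mkseq => /subseqP [m _]; rewrite -map_mask.
  have : sorted ltn (mask m (iota 0 (size s))).
    exact: (subseq_sorted ltn_trans (mask_subseq _ _) (iota_ltn_sorted _ _)).
  have : {subset mask m (iota 0 (size s)) <= iota 0 (size s)}.
    exact/mem_subseq/mask_subseq.
  case: (mask _ _) => [|i [|k [|j [|? ?]]]] //= sub /and3P [ik kj _].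
  case=> -> -> eq_ij.
  have i_s := sub i (mem_head _ _).
  have : j \in iota 0 (size s) by apply: sub; rewrite !inE eqxx !orbT.
  rewrite mem_iota => j_s.
  have j_i : j \in iota i.+1 (size s - i.+1) by rewrite mem_iota; lia.
  move/allP/(_ _ j_i): (hs i i_s); rewrite eq_ij eqxx /=.
  by move/allP; apply; rewrite mem_iota; lia.
apply/allP=> i; rewrite mem_iota => i_s.
apply/allP=> j; rewrite mem_iota => j_s.
case: eqP => //= eq_ij; apply/allP => k; rewrite mem_iota => k_ij.
apply: hs; rewrite {2}eq_ij -{4}(mkseq_nth 0 s).
apply: (@map_subseq _ _ (nth 0 s) [:: i; k; j]).
suff -> : [:: i; k; j] = [seq l <- iota 0 (size s) | l \in [:: i; k; j]].
  exact: filter_subseq.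
apply: (irr_sorted_eq ltn_trans ltnn) => /=.
- by apply/and3P; split=> //; lia.
- exact: (sorted_filter ltn_trans _ (iota_ltn_sorted _ _)).
move=> l; rewrite mem_filter mem_iota !inE /=.
by do 3?[case: eqP => [->|_] /=]; lia.
Qed.

Lemma subseq_cons_catl (T : eqType) (k : T) (t u v : seq T) :
  k \notin u -> subseq (k :: t) (u ++ v) = subseq (k :: t) v.
Proof.
elim: u => //= x u IHu; rewrite inE negb_or => /andP [/negPf kx ku].
by rewrite kx IHu.
Qed.

Definition insert2 (k j : nat) (s : seq nat) : seq nat :=
  take j s ++ k :: k :: drop j s.

Lemma insert2_0 k s : insert2 k 0 s = [:: k, k & s].
Proof. by rewrite /insert2 take0 drop0. Qed.

Lemma insert2S k j x s : insert2 k j.+1 (x :: s) = x :: insert2 k j s.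
Proof. by []. Qed.

Lemma perm_insert2 k j s : perm_eq (insert2 k j s) (s ++ [:: k; k]).
Proof.
by rewrite /insert2 -{3}(cat_take_drop j s) -catA perm_cat2l perm_sym perm_catC.
Qed.

Lemma filter_insert2 k j s :
  k \notin s -> [seq x <- insert2 k j s | x != k] = s.
Proof.
move=> ks; rewrite filter_cat /= eqxx /= -filter_cat cat_take_drop.
by apply/all_filterP/allP => x xs; apply: contraNneq ks => <-.
Qed.

Lemma index_insert2 k j s : k \notin s -> j <= size s -> index k (insert2 k j s) = j.
Proof.
move=> ks js; rewrite index_cat ifN /= ?eqxx ?addn0 ?size_takel //.
by apply: contra ks; apply: mem_take.
Qed.

(** Two letters are inserted, so [index] shifts by 0 or 2. *)
Lemma odd_index_insert2 k j s i :
  i != k -> odd (index i (insert2 k j s)) = odd (index i s).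
Proof.
move=> ik; rewrite -{2}(cat_take_drop j s) !index_cat /= eq_sym (negPf ik).
by case: ifP => // _; rewrite !addnS /= negbK.
Qed.

(** Deleting [k] leaves a subsequence. Conversely, in a triple x y x of the longer word, x = [k] is
    impossible because the only two copies of [k] are adjacent; y = [k] gives x < y by maximality;
    any other triple already occurs in [s]. *)
Lemma stirlingb_insert2 k j s :
  all (ltn^~ k) s -> stirlingb (insert2 k j s) = stirlingb s.
Proof.
move=> /allP sk; have ks : k \notin s by apply/negP => /sk /=; rewrite ltnn.
have kt : k \notin take j s by apply: contra ks; apply: mem_take.
have kd : k \notin drop j s by apply: contra ks; apply: mem_drop.
apply/stirlingbP/stirlingbP => hs x y sub.
  apply: hs; apply: subseq_trans sub _.
  by rewrite -{1}(filter_insert2 j ks) filter_subseq.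
have [xk|xk] := eqVneq x k.
  move: sub; rewrite {}xk (subseq_cons_catl _ _ kt) /= eqxx.
  case: eqP => [_|_]; first by rewrite sub1seq (negPf kd).
  by move/mem_subseq/(_ k); rewrite !inE eqxx orbT => /(_ isT); rewrite (negPf kd).
have xs : x \in s.
  rewrite -(filter_insert2 j ks) mem_filter xk.
  by apply: (mem_subseq sub); rewrite inE eqxx.
have [->|yk] := eqVneq y k; first exact: sk.
apply: hs; rewrite -(filter_insert2 j ks) subseq_filter sub andbT /=.
by rewrite xk yk.
Qed.

(** * Stirling permutations of order n + 1 as insertions into those of order n *)

Lemma multiset2S n : multiset2 n.+1 = multiset2 n ++ [:: n.+1; n.+1].
Proof. by rewrite /multiset2 -{1}(addn1 n) iotaD map_cat flatten_cat. Qed.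

Lemma stirling_permsP n s :
  (s \in stirling_perms n) = stirlingb s && perm_eq s (multiset2 n).
Proof. by rewrite mem_filter mem_permutations. Qed.

Lemma size_stirling_perm n s : s \in stirling_perms n -> size s = n.*2.
Proof.
rewrite stirling_permsP => /andP [_ /perm_size ->].
by elim: n => // n IHn; rewrite multiset2S size_cat IHn addn2.
Qed.

Lemma perm_multiset2_lt n s : perm_eq s (multiset2 n) -> all (ltn^~ n.+1) s.
Proof.
move/perm_all ->; elim: n => // n IHn; rewrite multiset2S all_cat /= ltnSn !andbT.
by apply: sub_all IHn => i /= /ltnW; rewrite ltnS.
Qed.

Lemma stirling_perm_lt n s : s \in stirling_perms n -> all (ltn^~ n.+1) s.
Proof. by rewrite stirling_permsP => /andP [_ /perm_multiset2_lt]. Qed.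

Lemma notin_stirling_perm n s : s \in stirling_perms n -> n.+1 \notin s.
Proof. by move/stirling_perm_lt/allP => h; apply/negP => /h /=; rewrite ltnn. Qed.

Lemma insert2_stirling n j s :
  s \in stirling_perms n -> insert2 n.+1 j s \in stirling_perms n.+1.
Proof.
move=> sn; move: (sn).
rewrite !stirling_permsP stirlingb_insert2 ?stirling_perm_lt // => /andP [-> sp].
by rewrite multiset2S (perm_trans (perm_insert2 _ _ _)) // perm_cat2r.
Qed.

Lemma stirling_insert2 n t : t \in stirling_perms n.+1 ->
  exists s j, [/\ s \in stirling_perms n, j <= size s & t = insert2 n.+1 j s].
Proof.
move=> tn; have t_lt := stirling_perm_lt tn.
move: (tn); rewrite stirling_permsP => /andP [/stirlingbP t_st t_perm].
have t_count : count_mem n.+1 t >= 2.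
  by rewrite (seq.permP t_perm) multiset2S count_cat /= eqxx leq_addl.
have kt : n.+1 \in t by rewrite -has_pred1 has_count; lia.
(* Cut [t] just before the first copy of the maximum. *)
set u := take (index n.+1 t) t.
have ku : n.+1 \notin u by rewrite in_take // ltnn.
have tE : t = u ++ n.+1 :: drop (index n.+1 t).+1 t.
  by rewrite -{1}(nth_index 0 kt) -drop_nth ?index_mem // cat_take_drop.
clearbody u; move: (drop _ t) tE => v tE; subst t; clear kt.
have kv : n.+1 \in v.
  move: t_count; rewrite -has_pred1 has_count count_cat (count_memPn ku) add0n /=.
  by rewrite eqxx.
case: v => [|y v] // in t_lt tn t_st t_perm t_count kv *.
(* Otherwise the second copy stands further right, and the Stirling condition would force [y] above
   the maximum. *)
have yk : n.+1 = y.
  apply/eqP; move: kv; rewrite inE => /orP [//|kv].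
  have /t_st : subseq [:: n.+1; y; n.+1] (u ++ [:: n.+1, y & v]).
    by rewrite subseq_cons_catl //= !eqxx sub1seq.
  by move/allP/(_ y): t_lt; rewrite mem_cat !inE eqxx !orbT => /(_ isT) /=; lia.
subst y; exists (u ++ v), (size u).
have tE : u ++ [:: n.+1, n.+1 & v] = insert2 n.+1 (size u) (u ++ v).
  by rewrite /insert2 take_size_cat // drop_size_cat.
have uv_perm : perm_eq (u ++ v) (multiset2 n).
  rewrite -(perm_cat2r [:: n.+1; n.+1]) -multiset2S (perm_trans _ t_perm) // tE.
  by rewrite perm_sym perm_insert2.
split=> //; last by rewrite size_cat leq_addr.
rewrite stirling_permsP uv_perm andbT.
rewrite -(stirlingb_insert2 (size u) (perm_multiset2_lt uv_perm)) -tE.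
exact/stirlingbP.
Qed.

Lemma perm_stirling_permsS n :
  perm_eq (stirling_perms n.+1)
    [seq insert2 n.+1 j s | s <- stirling_perms n, j <- iota 0 n.*2.+1].
Proof.
have st q : q \in [seq (s, j) | s <- stirling_perms n, j <- iota 0 n.*2.+1] ->
    q.1 \in stirling_perms n /\ q.2 <= size q.1.
  case/allpairsP => [[s j] [sn jn ->]]; split=> //; move: jn.
  by rewrite mem_iota ltnS (size_stirling_perm sn).
apply: uniq_perm.
- exact/filter_uniq/permutations_uniq.
- apply: allpairs_uniq; [exact/filter_uniq/permutations_uniq | exact: iota_uniq |].
  (* Injectivity: deleting the maximum recovers [s], and its first position recovers [j]. *)
  move=> [s j] [s' j'] /st /= [/notin_stirling_perm sn js].
  move=> /st /= [/notin_stirling_perm s'n js'] eq_ins.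
  have ss : s = s' by rewrite -(filter_insert2 j sn) eq_ins filter_insert2.
  by congr pair => //; rewrite -(index_insert2 sn js) eq_ins index_insert2.
move=> t; apply/idP/allpairsP => [/stirling_insert2 [s [j [sn js ->]]] | [[s j]]].
  exists (s, j); split=> //; rewrite mem_iota ltnS.
  by rewrite -(size_stirling_perm sn).
by move=> [sn _ ->]; apply: insert2_stirling.
Qed.

Lemma even_idx_insert2 n j s : s \in stirling_perms n -> j <= size s ->
  even_idx n.+1 (insert2 n.+1 j s) = even_idx n s + odd j.
Proof.
move=> sn js; rewrite /even_idx.
have -> : iota 1 n.+1 = iota 1 n ++ [:: n.+1] by rewrite -{1}(addn1 n) iotaD.
rewrite count_cat /= addn0 index_insert2 ?notin_stirling_perm //; congr addn.
apply: eq_in_count => i; rewrite mem_iota => i_n.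
by rewrite odd_index_insert2 //; lia.
Qed.

(** Counts the ascent plateaus of [p :: s], carrying the preceding entry so that inductions can
    follow the word. The last entry never counts, since [ohead] is then [None]. *)
Fixpoint ap_from (p : nat) (s : seq nat) : nat :=
  if s is y :: s' then ((p < y) && (ohead s' == Some y)) + ap_from y s' else 0.

Lemma ap_cons p s : ap (p :: s) = ap_from p s.
Proof.
elim: s p => // y [|z s] IHs p; first by rewrite /ap /= andbF.
rewrite [ap_from _ _]/= -/(ap_from y (z :: s)) -IHs /ap /= subn2 /=.
congr addn; first by rewrite eq_sym.
rewrite (iotaDl 1 1) count_map; apply: eq_in_count => i.
by rewrite mem_iota; case: i.
Qed.

Lemma ap_from_max k y s : y < k -> ap_from k (y :: s) = ap_from y s.
Proof. by move=> yk; rewrite /= ltnNge ltnW. Qed.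

Lemma ap_from_lt p y k s : y < k -> ap_from p [:: y, k & s] = ap_from y (k :: s).
Proof.
move=> yk; have -> : ap_from p [:: y, k & s]
  = ((p < y) && (k == y)) + ap_from y (k :: s) by [].
by rewrite (gtn_eqF yk) andbF.
Qed.

Lemma ap_from_max2 p k s : p < k -> ap_from p (k :: k :: s) = (ap_from k s).+1.
Proof. by move=> pk; rewrite /= pk eqxx ltnn. Qed.

End Insertion.

(** * The signed sum over all gaps *)

Section SignedSum.
Set Implicit Arguments. Unset Strict Implicit.
Variables (R : comNzRingType) (x : R).

(** If every gap contributed one new ascent plateau, the result would be this power of x times the
    alternating count of the [size s + 1] gaps. The two corrections due to each old ascent plateau
    sit at consecutive gaps and cancel. *)
Lemma sum_insert2_from (k p : nat) (s : seq nat) :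
  (p < k)%N -> all (ltn^~ k) s ->
  \sum_(0 <= j < (size s).+1) (-1) ^+ j * x ^+ ap_from p (insert2 k j s)
    = if odd (size s) then 0 else x ^+ (ap_from p s).+1.
Proof.
elim: s p => [|y s IHs] p pk.
  by rewrite big_nat1 insert2_0 ap_from_max2 // expr0 mul1r.
move=> /andP [yk sk]; rewrite big_nat_recl // expr0 mul1r.
rewrite insert2_0 ap_from_max2 // ap_from_max //.
case: s sk IHs => [_ _|z s sk IHs].
  by rewrite big_nat1 insert2S insert2_0 ap_from_lt // ap_from_max2 //=; ring.
have zk : (z < k)%N by case/andP: sk.
have {IHs} := IHs y yk sk.
rewrite (big_nat_recl _ 0) // expr0 mul1r insert2_0 ap_from_max2 // (ap_from_max _ zk).
(* The induction hypothesis starts at the gap before [z]; [T] collects the later gaps. The gaps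
   before [y] and before [z] are treated by hand, as both can destroy a plateau at [y]. *)
set T := (X in _ + X = _) => T_sum.
(* [b] and [c] tell whether an ascent plateau starts at [y], respectively at [z]; not both, since
   [b] forces z = y. *)
set b := ((p < y) && (z == y))%N; set c := ((y < z)%N && (ohead s == Some z)).
have bc : ~~ (b && c).
  by rewrite /b /c; apply/negP => /andP [/andP [_ /eqP ->]]; rewrite ltnn.
have ap_y : ap_from y (z :: s) = (c + ap_from z s)%N by [].
have ap_p : ap_from p [:: y, z & s] = (b + (c + ap_from z s))%N by [].
rewrite (big_nat_recl _ 0) // insert2S insert2_0 ap_from_lt // ap_from_max2 //.
rewrite (ap_from_max _ zk).
(* Beyond [z] the plateau at [y] survives, giving the factor [x ^+ b]; the shift of the gap index by
   one gives the sign. *)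
have -> : \sum_(0 <= j < (size s).+1)
    (-1) ^+ j.+2 * x ^+ ap_from p (insert2 k j.+2 [:: y, z & s]) = - (x ^+ b * T).
  rewrite mulr_sumr -sumrN; apply: eq_bigr => j _.
  have -> : ap_from p (insert2 k j.+2 [:: y, z & s])
      = (b + ap_from y (insert2 k j.+1 (z :: s)))%N by [].
  rewrite exprD (exprS _ j.+1); ring.
have {T_sum} -> : T = (if odd (size s).+1 then 0 else x ^+ (c + ap_from z s).+1)
    - x ^+ (ap_from z s).+1 by rewrite -ap_y -T_sum; ring.
rewrite ap_p ap_y /= negbK.
case: b c bc {ap_y ap_p} => [] [] // _; case: (odd _) => /=.
all: rewrite ?add0n ?add1n ?exprS; ring.
Qed.

(** A leading pair has no predecessor and creates no ascent plateau, so gap 0 contributes the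
    right-hand side. The other gaps lie after the first entry, in a tail of odd length, where the
    sum is 0. *)
Lemma sum_insert2 (k : nat) (s : seq nat) :
  all (ltn^~ k) s -> ~~ odd (size s) ->
  \sum_(0 <= j < (size s).+1) (-1) ^+ j * x ^+ ap (insert2 k j s) = x ^+ ap s.
Proof.
case: s => [_ _|q s sk even_s].
  by rewrite big_nat1 expr0 mul1r insert2_0 /ap /= expr0.
have qk : (q < k)%N by case/andP: sk.
rewrite big_nat_recl // expr0 mul1r insert2_0 !ap_cons.
have -> : ap_from k [:: k, q & s] = ap_from q s.
  by rewrite -[RHS](ap_from_max _ qk) /= ltnn.
under eq_bigr => j _ do rewrite insert2S ap_cons exprS -mulrA.
rewrite -mulr_sumr sum_insert2_from //; last by case/andP: sk.
by move: even_s => /= /negPn ->; rewrite mulr0 addr0.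
Qed.

Lemma stirling_sum n :
  \sum_(s <- stirling_perms n) x ^+ ap s * (-1) ^+ even_idx n s = 1.
Proof.
elim: n => [|n IHn]; first by rewrite big_seq1 /= !expr0 mulr1.
rewrite (perm_big _ (perm_stirling_permsS n)) big_allpairs_dep -[RHS]IHn.
rewrite big_seq [RHS]big_seq; apply: eq_bigr => s sn.
have s_even : ~~ odd (size s) by rewrite (size_stirling_perm sn) odd_double.
rewrite -(sum_insert2 (stirling_perm_lt sn) s_even) mulr_suml.
rewrite -(size_stirling_perm sn) -[iota 0 _]/(index_iota 0 (size s).+1).
rewrite big_nat_cond [RHS]big_nat_cond; apply: eq_bigr => j.
rewrite andbT => /andP [_ js].
by rewrite even_idx_insert2 // exprD signr_odd; ring.
Qed.

End SignedSum.

(** * Alternating sums over marks *)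

Section MarkedPermutations.
Set Implicit Arguments. Unset Strict Implicit.

Lemma sum_sign_subset (R : comNzRingType) (I : finType) (A : {set I}) :
  \sum_(M : {set I} | M \subset A) (-1) ^+ #|M| = (A == set0)%:R :> R.
Proof.
(* The factor is 0 on [A] and 1 elsewhere. Expanding it over the set [M] of indices where the first
   summand is chosen kills every [M] not inside [A]. *)
transitivity (\prod_(i : I) (- (i \in A)%:R + 1) : R).
  rewrite bigA_distr big_mkcond; apply: eq_bigr => M _.
  rewrite -big_mkcond /=; case: ifP => MA.
    rewrite -prodr_const; apply: eq_bigr => i iM.
    by rewrite (subsetP MA _ iM).
  have /subsetPn [i iM iA] : ~~ (M \subset A) by rewrite MA.
  by rewrite (bigD1 i) //= (negPf iA) oppr0 mul0r.
have [->|/set0Pn [i iA]] := eqVneq A set0.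
  by rewrite big1 // => i _; rewrite inE oppr0 add0r.
by rewrite (bigD1 i) //= iA addNr mul0r.
Qed.

Lemma all_lrminP n (p : 'S_n) :
  reflect (p = perm (@rev_ord_inj n)) [forall i, lrmin p i].
Proof.
apply: (iffP forallP) => [p_min | -> i]; last first.
  by apply/forallP => j; apply/implyP => ji; rewrite !permE /=; have := ltn_ord i; lia.
have p_dec (i j : 'I_n) : (j < i)%N -> (p i < p j)%N.
  by move: (p_min i) => /forallP /(_ j) /implyP.
(* A strictly decreasing [p] is squeezed onto the reversal: an upper bound by induction from the
   left end, a lower bound from the right end. *)
have p_le m (i : 'I_n) : i = m :> nat -> (p i <= n - m.+1)%N.
  elim: m i => [|m IHm] i im; first by have := ltn_ord (p i); lia.
  have mn : (m < n)%N by have := ltn_ord i; lia.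
  have := IHm (Ordinal mn) erefl; have := @p_dec i (Ordinal mn) => /=; lia.
have p_ge m (i : 'I_n) : (n - i.+1 = m -> m <= p i)%N.
  elim: m i => // m IHm i im.
  have i_n : (i.+1 < n)%N by lia.
  have := IHm (Ordinal i_n); have := @p_dec (Ordinal i_n) i => /=; lia.
apply/permP => i; apply: val_inj; rewrite permE /=; apply/eqP.
by rewrite eqn_leq p_le //= p_ge.
Qed.

Lemma asc_rev n : asc (perm (@rev_ord_inj n)) = 0%N.
Proof.
apply/eqP; rewrite cards_eq0; apply/eqP/setP => i; rewrite !inE.
by apply/negbTE/existsPn => j; rewrite !permE /=; lia.
Qed.

Lemma marked_sum (R : comNzRingType) (x : R) n :
  \sum_(pm : 'S_n * {set 'I_n} | marked pm) x ^+ asc pm.1 * (-1) ^+ mark pm = 1.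
Proof.
rewrite -(pair_big_dep xpredT (fun p M => marked (p, M))
            (fun p M => x ^+ asc p * (-1) ^+ #|M|)) /=.
have sum_p (p : 'S_n) : \sum_(M : {set 'I_n} | marked (p, M)) x ^+ asc p * (-1) ^+ #|M|
    = x ^+ asc p * (p == perm (@rev_ord_inj n))%:R.
  rewrite -mulr_sumr.
  (* The marks range over the subsets of the set of entries that are not left-to-right minima, empty
     exactly for the reversal. *)
  have -> : (p == perm (@rev_ord_inj n)) = ([set i | ~~ lrmin p i] == set0).
    apply/eqP/eqP => [/all_lrminP/forallP p_min | p0].
      by apply/setP => i; rewrite !inE p_min.
    by apply/all_lrminP/forallP => i; move/setP/(_ i): p0; rewrite !inE => /negbFE.
  rewrite -sum_sign_subset; congr (_ * _); apply: eq_bigl => M.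
  by apply/forall_inP/subsetP => h i /h; rewrite inE.
under eq_bigr do rewrite sum_p.
rewrite (bigD1 (perm (@rev_ord_inj n))) //= eqxx asc_rev mulr1 expr0 big1 ?addr0 //.
by move=> p /negPf ->; rewrite mulr0.
Qed.

End MarkedPermutations.

Theorem theorem2 (n : nat) : (1 <= n)%N ->
  (\sum_(s <- stirling_perms n) 'X^(ap s) * (-1) ^+ (even_idx n s)
     = \sum_(pm : 'S_n * {set 'I_n} | marked pm)
          'X^(asc pm.1) * (-1) ^+ (mark pm) :> {poly int})
  /\
  (\sum_(pm : 'S_n * {set 'I_n} | marked pm)
          'X^(asc pm.1) * (-1) ^+ (mark pm) = 1 :> {poly int}).
Proof. by move=> _; rewrite stirling_sum marked_sum. Qed.
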